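(* Let $\Lambda$ be a finite measure on $[0,1]$ with $\Lambda(\{1\})=0$, let $(\Pi_t)_{t\ge0}$ be the $\Lambda$-coalescent and $\mathcal{F}_t=\sigma(\Pi_s: s\le t)$. Let $T>0$ and let $\mathcal{W}=\{w_i: i\in\mathbb{N}\}$ be a random, $\mathcal{F}_T$-measurable, infinite subset of $\mathbb{N}$ with $w_i<w_j$ whenever $i<j$, such that $\mathcal{W}$ contains precisely one element of each block of $\Pi_T$. For $n\in\mathbb{N}$ and $t\ge0$ let $\mathrm{bl}_{\Pi_t}(n)$ be the unique block of $\Pi_t$ containing $n$. Define a process $(\widetilde\Pi_t)_{t\ge T}$ of partitions of $\mathbb{N}$ by: $i$ and $j$ are in the same block of $\widetilde\Pi_t$ if and only if $\mathrm{bl}_{\Pi_t}(w_i)=\mathrm{bl}_{\Pi_t}(w_j)$. Then $(\widetilde\Pi_t)_{t\ge T}$ is a $\Lambda$-coalescent (with initial time $T$).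
   Context: For $n\in\mathbb{N}$, let $\iota_n$ be the restriction map from partitions of $\mathbb{N}$ to partitions of $\{1,\dots,n\}$. A $\Lambda$-coalescent with initial time $T\ge 0$ is a Markov process $(\Pi_t)_{t\ge T}$ with values in partitions of $\mathbb{N}$, with $\Pi_T$ the partition into singletons, such that for every $n$, $\iota_n(\Pi_t)$ is a Markov chain in which, whenever it has $i$ blocks, each particular $k$-tuple of blocks ($2\le k\le i$) merges into one block at rate $\lambda_{i,k}=\int_0^1x^{k-2}(1-x)^{i-k}\Lambda(dx)$, independently of all other $k$-tuples. ''The $\Lambda$-coalescent'' means the one with initial time $0$. *)

(* Defs.v *)
From HB Require Import structures.
From mathcomp Require Import all_boot all_order all_algebra.
From mathcomp Require Import all_classical all_reals all_analysis.
Set Implicit Arguments. Unset Strict Implicit. Unset Printing Implicit Defensive.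
Import Order.TTheory GRing.Theory Num.Theory.
Import numFieldNormedType.Exports.
Local Open Scope classical_set_scope.
Local Open Scope ring_scope.

(* A partition of N is represented by its equivalence relation
   [X : nat -> nat -> bool] ("i and j in the same block").  N is taken
   0-based; {1,...,n} is represented by 'I_n = {0,...,n-1}. *)

Definition restr (n : nat) (X : nat -> nat -> bool) : {set {set 'I_n}} :=
  equivalence_partition (fun i j : 'I_n => X i j) [set: 'I_n].

Definition singletons (n : nat) : {set {set 'I_n}} :=
  restr n (fun i j => i == j).

Section Coal.
Variable R : realType.
Variable Lambda : {finite_measure set R -> \bar R}.

Definition lam (i k : nat) : R :=
  fine (\int[Lambda]_(x in `[0%R, 1%R]%classic) ((x ^+ (k - 2) * (1 - x) ^+ (i - k))%:E))%E.

(* off-diagonal rate from a to b: sum over the sets S of k >= 2 blocks of a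
   whose merger produces b (at most one such S) of lambda_{#|a|, k} *)
Definition offrate (n : nat) (a b : {set {set 'I_n}}) : R :=
  \sum_(S : {set {set 'I_n}} | (S \subset a) && (2 <= #|S|)%N &&
                               (b == ((a :\: S) :|: [set finset.cover S])%SET))
    lam #|a| #|S|.

Definition rate (n : nat) (a b : {set {set 'I_n}}) : R :=
  if a == b then - \sum_(c : {set {set 'I_n}} | c != a) offrate a c
  else offrate a b.

Fixpoint Qpow (n k : nat) (a b : {set {set 'I_n}}) : R :=
  match k with
  | 0 => (a == b)%:R
  | k'.+1 => \sum_(c : {set {set 'I_n}}) Qpow k' a c * rate c b
  end.

Definition trans (n : nat) (t : R) (a b : {set {set 'I_n}}) : R :=
  limn (fun N : nat => \sum_(k < N) (t ^+ k / (k`!)%:R * Qpow k a b)).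

Fixpoint fidi (n : nat) (t0 : R) (a : {set {set 'I_n}})
    (l : seq (R * {set {set 'I_n}})) : R :=
  match l with
  | [::] => 1
  | (t, b) :: l' => trans (t - t0) a b * fidi t b l'
  end.

(* Lambda-coalescent with initial time T0: for every n the restriction
   iota_n(X_t), t >= T0, is a (measurable) continuous-time Markov chain
   with generator [rate], started at the singletons at time T0,
   characterised through its finite-dimensional distributions. *)
Definition lambda_coalescent (d : measure_display) (Omega : measurableType d)
    (P : probability Omega R) (T0 : R) (X : R -> Omega -> nat -> nat -> bool)
    : Prop :=
  (forall t w, T0 <= t -> equivalence_rel (X t w)) /\
  forall n : nat,
    (forall (t : R) (S : {set {set 'I_n}}), T0 <= t ->
        measurable [set w | restr n (X t w) = S]) /\
    (forall l : seq (R * {set {set 'I_n}}),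
        path (fun p q => p.1 <= q.1) (T0, singletons n) l ->
        P [set w | all (fun p => restr n (X p.1 w) == p.2) l]
          = (fidi T0 (singletons n) l)%:E).

Definition natural_gens (d : measure_display) (Omega : measurableType d)
    (X : R -> Omega -> nat -> nat -> bool) (t : R) : set (set Omega) :=
  [set A | exists (s : R) (n : nat) (S : {set {set 'I_n}}),
      0 <= s <= t /\ A = [set w | restr n (X s w) = S]].

End Coal.

(* Main.v *)
Require Import Defs.
From HB Require Import structures.
From mathcomp Require Import all_boot all_order all_algebra.
From mathcomp Require Import all_classical all_reals all_analysis.
From mathcomp Require Import measurable_realfun ring.
Import Order.TTheory GRing.Theory Num.Theory.
Local Open Scope classical_set_scope.
Local Open Scope ring_scope.

(* For a map [f] from 'I_m to 'I_N, partitions of 'I_N pull back to partitions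
   of 'I_m. The identity lambda_{i,k} = lambda_{i+1,k} + lambda_{i+1,k+1} makes
   the chain on partitions of 'I_N lumpable along every such pullback, the image
   being the chain on partitions of 'I_m; the same then holds for its transition
   matrices and finite-dimensional distributions. With [f] an inclusion, this
   brings finitely many events of the past to a common level, and a pi-lambda
   argument gives the Markov property with respect to F_T; with [f] = k a choice
   of labels, it shows that after time T the partition sampled at k_0,...,k_{n-1}
   evolves given F_T as the n-coalescent started from its state at T. On the
   F_T-event that (W_0,...,W_{n-1}) = k, that state is the partition into
   singletons, and it remains to sum over the countably many k. *)

(** * Pullbacks of partitions *)

Section Combinatorics.
Import mathcomp.boot.fintype mathcomp.boot.finset.
Local Open Scope set_scope.
Set Implicit Arguments.
Unset Strict Implicit.

(* Iterates the two-term recursion over the elements of [a :\: v]: each of them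
   is either left out of [S] or put into it. *)
Lemma sum_subsets_trace (T : finType) (V : zmodType) (F : nat -> nat -> V)
    (k0 : nat) (a v S1 : {set T}) :
    (forall i k, (k0 <= k <= i)%N -> F i k = F i.+1 k + F i.+1 k.+1)%R ->
    v \subset a -> S1 \subset v -> (k0 <= #|S1|)%N ->
  (\sum_(S : {set T} | (S \subset a) && (S :&: v == S1)) F #|a| #|S|
    = F #|v| #|S1|)%R.
Proof.
move=> FS + sv kS; elim: {a}#|a :\: v| {-2}a (erefl #|a :\: v|) => [|n IH] a.
  move=> /eqP; rewrite cards_eq0 setD_eq0 => sav sva.
  have -> : a = v by apply/eqP; rewrite eqEsubset sav sva.
  rewrite (big_pred1 S1) // => S; apply/andP/eqP => [[/setIidPl-> /eqP //]|->].
  by split => //; apply/eqP/setIidPl.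
move=> card_av sva.
have [B] : exists B, B \in a :\: v by apply/card_gt0P; rewrite card_av.
rewrite inE => /andP[vB aB]; pose a' := a :\ B.
have sva' : v \subset a'.
  by apply/subsetP => x vx; rewrite !inE (subsetP sva) // andbT;
     apply: contraNneq vB => <-.
have card_a : #|a| = #|a'|.+1 by rewrite (cardsD1 B) aB.
rewrite -(IH a') //; last first.
  apply/eqP; rewrite -eqSS -card_av (cardsD1 B (a :\: v)) !inE vB aB add1n eqSS.
  by apply/eqP/eq_card => x; rewrite !inE andbCA.
rewrite (bigID (fun S : {set T} => B \in S)) /= addrC.
under [in RHS]eq_bigr => S /andP[sSa' /eqP SvS1].
  rewrite FS; last first.
    by rewrite subset_leq_card // (leq_trans kS) // -SvS1 subset_leq_card ?subsetIl.
  over.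
rewrite big_split /=; congr (_ + _)%R.
  apply: eq_big => [S|S _]; last by rewrite card_a.
  by rewrite subsetD1 andbAC.
rewrite (reindex_onto (fun S => B |: S) (fun S => S :\ B)) /=; last first.
  by move=> S /andP[_ BS]; rewrite setD1K.
apply: eq_big => [S|S].
  have BI : B \notin S -> (B |: S) :&: v = S :&: v.
    move=> BS; apply/setP => x; rewrite !inE.
    by case: eqP => // ->; rewrite (negbTE vB) !andbF.
  rewrite subsetD1 setU11 andbT subUset sub1set aB /=.
  have [BS|BS] := boolP (B \in S).
    rewrite !andbF /=; apply/negP => /andP[_ /eqP e].
    by move: BS; rewrite -e !inE eqxx.
  by rewrite BI // setU1K // eqxx !andbT.
move=> /andP[_ /eqP e].
have BS : B \notin S by rewrite -e !inE eqxx.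
by rewrite card_a cardsU1 BS add1n.
Qed.

Definition merge {N : nat} (a S : {set {set 'I_N}}) : {set {set 'I_N}} :=
  (a :\: S) :|: [set cover S].

(* Blocks of [a] not met by [f] have empty preimage, hence the removal of [set0]. *)
Definition pull {m N : nat} (f : 'I_m -> 'I_N) (a : {set {set 'I_N}}) :
    {set {set 'I_m}} :=
  [set f @^-1: (B : {set 'I_N}) | B in a] :\ set0.

Lemma pullP m N (f : 'I_m -> 'I_N) (a : {set {set 'I_N}}) (C : {set 'I_m}) :
  reflect (exists2 B, B \in a & C != set0 /\ C = f @^-1: B) (C \in pull f a).
Proof.
rewrite in_setD1; apply: (iffP andP) => [[C0 /imsetP[B aB eC]]|[B aB [C0 eC]]].
  by exists B.
by split => //; apply/imsetP; exists B.
Qed.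

Lemma partition_setTP (T : finType) (a : {set {set T}}) :
  partition a [set: T] <->
  [/\ set0 \notin a, forall x, exists2 B, B \in a & x \in B &
   forall B C x, B \in a -> C \in a -> x \in B -> x \in C -> B = C].
Proof.
split.
  move=> /and3P[/eqP ca /trivIsetP ta a0]; split => //.
    move=> x; have : x \in cover a by rewrite ca.
    by move=> /bigcupP[B aB xB]; exists B.
  move=> B C x aB aC xB xC; apply/eqP; apply/negPn/negP => BC.
  by have /pred0P/(_ x) := ta _ _ aB aC BC; rewrite /= xB xC.
case=> a0 ca ta; apply/and3P; split => //.
  apply/eqP/setP => x; rewrite inE; have [B aB xB] := ca x.
  by apply/bigcupP; exists B.
apply/trivIsetP => B C aB aC BC; apply/pred0P => x /=; apply/negP.
by move=> /andP[xB xC]; move: BC; rewrite (ta B C x) ?eqxx.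
Qed.

Lemma merge_partition N (a S : {set {set 'I_N}}) :
  partition a setT -> S \subset a -> S != set0 -> partition (merge a S) setT.
Proof.
move=> /partition_setTP[a0 ca ta] /subsetP Sa /set0Pn[D SD].
have DP x B : B \in a -> B \notin S -> x \in B -> x \notin cover S.
  move=> aB SB xB; apply/negP => /bigcupP[C SC xC].
  by move: SB; rewrite (ta B C x) ?SC // Sa.
apply/partition_setTP; split.
- rewrite !inE (negbTE a0) andbF /=; apply/negP => /eqP e.
  have /set0Pn[x xD] : D != set0 by apply: contraNneq a0 => <-; exact: Sa.
  have : x \in cover S by apply/bigcupP; exists D.
  by rewrite -e inE.
- move=> x; have [B aB xB] := ca x.
  have [SB|SB] := boolP (B \in S).
    by exists (cover S); [rewrite !inE eqxx orbT|apply/bigcupP; exists B].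
  by exists B => //; rewrite !inE aB SB.
- move=> B C x; rewrite !inE => /orP[/andP[SB aB]|/eqP ->] /orP[/andP[SC aC]|/eqP ->] //.
  + exact: ta.
  + by move=> xB xC; have := DP _ _ aB SB xB; rewrite xC.
  + by move=> xB xC; have := DP _ _ aC SC xC; rewrite xB.
Qed.

Section Pull.
Variables (m N : nat) (f : 'I_m -> 'I_N) (a : {set {set 'I_N}}).
Hypothesis pa : partition a setT.

Lemma cover_pull S : cover (pull f S) = f @^-1: cover S.
Proof.
apply/setP => x; rewrite inE; apply/bigcupP/bigcupP.
  by move=> [_ /pullP[B SB [_ ->]]]; rewrite inE => xB; exists B.
move=> [B SB xB]; exists (f @^-1: B); last by rewrite inE.
by apply/pullP; exists B => //; split=> //; apply/set0Pn; exists x; rewrite inE.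
Qed.

Lemma pullS (S S' : {set {set 'I_N}}) : S \subset S' -> pull f S \subset pull f S'.
Proof.
move=> /subsetP SS; apply/subsetP => C /pullP[B SB ?].
by apply/pullP; exists B => //; exact: SS.
Qed.

Lemma preimset_block_inj (B C : {set 'I_N}) : B \in a -> C \in a -> f @^-1: B != set0 ->
  f @^-1: B = f @^-1: C -> B = C.
Proof.
move: pa => /partition_setTP[a0 ca ta] aB aC /set0Pn[x xB] e.
by apply: (ta _ _ (f x)) => //; [move: xB|move: xB; rewrite e]; rewrite inE.
Qed.

Lemma pull_merge (S : {set {set 'I_N}}) : S \subset a -> pull f S != set0 ->
  pull f (merge a S) = merge (pull f a) (pull f S).
Proof.
move=> /subsetP Sa S0; apply/setP => C; apply/pullP/idP.
  move=> [B + [C0 eC]]; rewrite eC => /setUP[/setDP[aB SB]|/set1P ->]; last first.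
    by apply/setUP; right; apply/set1P; rewrite cover_pull.
  apply/setUP; left; apply/setDP; split; last first.
    apply/negP => /pullP[B' SB' [B0 e]]; move: SB.
    by rewrite (preimset_block_inj (C := B') aB _ _ e) ?SB' -?eC // Sa.
  by apply/pullP; exists B => //; split => //; rewrite -eC.
rewrite /merge => /setUP[/setDP[/pullP[B aB [C0 eC]] CS]|].
  exists B => //; rewrite !inE aB andbT; apply/orP; left.
  by apply: contra CS => SB; apply/pullP; exists B.
rewrite inE => /eqP ->; exists (cover S); first by rewrite !inE eqxx orbT.
split; last exact: cover_pull.
have [D SD] := set0Pn _ S0.
have /pullP[_ _ [/set0Pn[x xD] _]] := SD.
by apply/set0Pn; exists x; apply/bigcupP; exists D.
Qed.

Lemma pull_merge_le1 (S : {set {set 'I_N}}) : S \subset a -> (#|pull f S| <= 1)%N ->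
  pull f (merge a S) = pull f a.
Proof.
move=> sSa; rewrite leq_eqVlt ltnS leqn0 cards_eq0 => /orP[/cards1P[D SD]|/eqP S0].
  rewrite pull_merge //; last by rewrite SD; apply/set0Pn; exists D; rewrite inE.
  rewrite SD /merge /cover big_set1 setUC setD1K //.
  by apply: (subsetP (pullS sSa)); rewrite SD inE.
apply/setP => C; apply/pullP/pullP => -[B aB [C0 eC]].
  move: aB; rewrite !inE => /orP[/andP[_ aB]|/eqP eB]; first by exists B.
  by move: C0; rewrite eC eB -cover_pull S0 /cover big_set0 eqxx.
exists B => //; rewrite !inE aB andbT; apply/orP; left; apply/negP => SB.
suff : C \in pull f S by rewrite S0 inE.
by apply/pullP; exists B.
Qed.

Let V := [set B in a | f @^-1: B != set0].

Lemma card_pull : #|pull f a| = #|V|.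
Proof.
rewrite -(card_in_imset (f := fun B : {set 'I_N} => f @^-1: B) (D := V)).
  apply: eq_card => C; apply/pullP/imsetP => [[B aB [C0 eC]]|[B]].
    by exists B => //; rewrite inE aB -eC.
  by rewrite inE => /andP[aB B0] ->; exists B.
move=> B C; rewrite !inE => /andP[aB B0] /andP[aC _].
exact: preimset_block_inj.
Qed.

Lemma sum_pull_eq (W : zmodType) (F : nat -> nat -> W) k0 (S' : {set {set 'I_m}}) :
    (forall i k, (k0 <= k <= i)%N -> F i k = F i.+1 k + F i.+1 k.+1)%R ->
    S' \subset pull f a -> (k0 <= #|S'|)%N ->
  (\sum_(S : {set {set 'I_N}} | (S \subset a) && (pull f S == S')) F #|a| #|S|
    = F #|pull f a| #|S'|)%R.
Proof.
move=> FS /subsetP sS' kS'; pose S1 := [set B in V | f @^-1: B \in S'].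
have imS1 : S' = [set f @^-1: (B : {set 'I_N}) | B in S1].
  apply/setP => C; apply/idP/imsetP => [CS'|[B]].
    have /pullP[B aB [C0 eC]] := sS' _ CS'.
    by exists B => //; rewrite !inE aB -eC C0.
  by rewrite !inE => /andP[_ ?] ->.
have cS1 : #|S'| = #|S1|.
  rewrite imS1 card_in_imset // => B C; rewrite !inE => /andP[/andP[aB B0] _].
  by move=> /andP[/andP[aC _] _]; exact: preimset_block_inj.
rewrite card_pull cS1 -(sum_subsets_trace (a := a) (v := V) (S1 := S1) FS) //; last 3 first.
- by apply/subsetP => B; rewrite inE => /andP[].
- by apply/subsetP => B; rewrite inE => /andP[].
- by rewrite -cS1.
apply: eq_bigl => S; apply: andb_id2l => /subsetP Sa.
have S1P B : B \in S -> f @^-1: B != set0 -> f @^-1: B \in pull f S.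
  by move=> SB B0; apply/pullP; exists B.
apply/eqP/eqP => [e|e].
  apply/setP => B; rewrite !inE; apply/idP/idP.
    by move=> /and3P[SB aB B0]; rewrite aB B0 /= -e S1P.
  move=> /andP[/andP[aB B0]]; rewrite aB B0 -e => /pullP[C SC [_ eC]].
  by rewrite (preimset_block_inj (B := B) (C := C)) ?SC // Sa.
rewrite imS1 -e; apply/setP => C; apply/pullP/imsetP => [[B SB [C0 eC]]|[B]].
  by exists B => //; rewrite !inE SB Sa // -eC C0.
by rewrite !inE => /and3P[SB aB B0] eC; exists B => //; rewrite eC.
Qed.

End Pull.

Lemma restr_partition n (X : nat -> nat -> bool) :
  equivalence_rel X -> partition (restr n X) setT.
Proof. by move=> eX; apply: equivalence_partitionP => x y z *; exact: eX. Qed.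

Lemma restrP n (X : nat -> nat -> bool) (B : {set 'I_n}) :
  reflect (exists i : 'I_n, B = [set j : 'I_n | X i j]) (B \in restr n X).
Proof.
apply: (iffP imsetP) => [[i _ ->]|[i ->]]; exists i => //; apply/setP => j;
  by rewrite !inE.
Qed.

Lemma pull_restr m N (f : 'I_m -> 'I_N) (k : nat -> nat) (X : nat -> nat -> bool) :
  equivalence_rel X -> (forall i : 'I_m, k i = f i :> nat) ->
  pull f (restr N X) = restr m (fun i j => X (k i) (k j)).
Proof.
move=> eX kf.
have Xr i : X i i by have [] := eX i i i.
have Xc i j l : X i j -> X i l = X j l by have [] := eX i j l.
apply/setP => C; apply/pullP/restrP.
  move=> [_ /restrP[x ->]] [+ eC]; rewrite eC => /set0Pn[i]; rewrite !inE => xi.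
  by exists i; apply/setP => j; rewrite !inE !kf; exact: Xc.
move=> [i ->]; exists [set j : 'I_N | X (f i) j].
  by apply/restrP; exists (f i).
split; first by apply/set0Pn; exists i; rewrite inE.
by apply/setP => j; rewrite !inE !kf.
Qed.

Lemma singletons_partition n : partition (Defs.singletons n) setT.
Proof.
by apply: restr_partition => x y z; split => // /eqP ->.
Qed.

End Combinatorics.

(** * Lumpability of the coalescent rates *)

Section Lumping.
Import mathcomp.boot.fintype mathcomp.boot.finset.
Set Implicit Arguments.
Unset Strict Implicit.
Variables (R : realType) (Lambda : {finite_measure set R -> \bar R}).

Lemma lam_integrable (p q : nat) :
  Lambda.-integrable `[0%R, 1%R]%classic
    (EFin \o (fun x : R => x ^+ p * (1 - x) ^+ q)).
Proof.
apply: measurable_bounded_integrable => //.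
- by rewrite ltey_eq fin_num_measure.
- apply: measurable_funM; first exact: measurable_funX.
  by apply: measurable_funX; apply: measurable_funB.
- exists 1; split => // M M1 x /=; rewrite in_itv /= => /andP[x0 x1].
  have y0 : 0 <= 1 - x by rewrite subr_ge0.
  have y1 : 1 - x <= 1 by rewrite lerBlDr lerDl.
  rewrite ger0_norm ?mulr_ge0 ?exprn_ge0 // (le_trans _ (ltW M1)) //.
  by rewrite mulr_ile1 ?exprn_ge0 ?exprn_ile1.
Qed.

Lemma lamS (i k : nat) : (2 <= k <= i)%N ->
  lam Lambda i k = lam Lambda i.+1 k + lam Lambda i.+1 k.+1.
Proof.
move=> /andP[k2 ki]; rewrite /lam.
rewrite -fineD; try exact/integrable_fin_num/lam_integrable.
rewrite -integralD_EFin //; try exact: lam_integrable.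
congr fine; apply: eq_integral => x _ /=; congr EFin.
rewrite (subSn k2) (subSn ki) (subSS k i) !exprS; ring.
Qed.

Lemma rate_off n (a b : {set {set 'I_n}}) : a != b -> rate Lambda a b = offrate Lambda a b.
Proof. by move=> /negbTE ab; rewrite /rate ab. Qed.

Lemma sum_rate n (a : {set {set 'I_n}}) : \sum_b rate Lambda a b = 0.
Proof.
rewrite (bigD1 a) //= {1}/rate eqxx.
rewrite (eq_bigr (offrate Lambda a)) ?addNr // => b ba.
by rewrite rate_off // eq_sym.
Qed.

Lemma rate_partition n (a b : {set {set 'I_n}}) :
  partition a [set: 'I_n] -> ~~ partition b [set: 'I_n] -> rate Lambda a b = 0.
Proof.
move=> pa pb; rewrite rate_off; last by apply: contraNneq pb => <-.
rewrite /offrate big_pred0 // => S; apply/negP => /andP[/andP[Sa S2] /eqP eb].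
move: pb; rewrite eb merge_partition //.
by rewrite -card_gt0 (leq_trans _ S2).
Qed.

Section Pull.
Variables (m N : nat) (f : 'I_m -> 'I_N).

Lemma offrate_pull (a : {set {set 'I_N}}) (c : {set {set 'I_m}}) :
  partition a [set: 'I_N] -> c != pull f a ->
  \sum_(b | pull f b == c) offrate Lambda a b = offrate Lambda (pull f a) c.
Proof.
move=> pa ca; rewrite /offrate.
rewrite (exchange_big_dep (fun S : {set {set 'I_N}} =>
  (S \subset a) && (2 <= #|S|)%N && (pull f (merge a S) == c))) /=; last first.
  by move=> b S /eqP <- /andP[-> /eqP ->]; rewrite eqxx.
pose Q (S' : {set {set 'I_m}}) :=
  (S' \subset pull f a) && (2 <= #|S'|)%N && (c == merge (pull f a) S').
have QP (S : {set {set 'I_N}}) : S \subset a ->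
    (pull f (merge a S) == c) = Q (pull f S).
  move=> Sa; rewrite /Q pullS //=; case: ltnP => [S2|S1] /=.
    by rewrite pull_merge // ?[RHS]eq_sym // -card_gt0 (leq_trans _ S2).
  by rewrite pull_merge_le1 // eq_sym (negbTE ca).
rewrite (partition_big (pull f) Q) /=; last first.
  by move=> S /andP[/andP[Sa _]]; rewrite QP.
apply: eq_bigr => S' /andP[/andP[S'a S'2] cS'].
rewrite -(sum_pull_eq pa lamS) //; apply: eq_big => S.
  have [Sa|//] := boolP (S \subset a); rewrite QP //=.
  case: eqP => [eS|]; rewrite ?andbF // eS /Q S'a S'2 cS' !andbT /=.
  rewrite (leq_trans S'2) // -eS (leq_trans _ (leq_imset_card (fun B : {set 'I_N} => f @^-1: B)%SET S)) //.
  by rewrite subset_leq_card // subsetDl.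
move=> /andP[/andP[SaS2 /eqP mc] _].
rewrite (big_pred1 (merge a S)) // => b /=; rewrite SaS2 /=.
by apply/andP/eqP => [[_ /eqP]//|->]; rewrite mc !eqxx.
Qed.

Lemma rate_pull (a : {set {set 'I_N}}) (c : {set {set 'I_m}}) :
  partition a [set: 'I_N] ->
  \sum_(b | pull f b == c) rate Lambda a b = rate Lambda (pull f a) c.
Proof.
move=> pa.
have off c' : c' != pull f a ->
    \sum_(b | pull f b == c') rate Lambda a b = offrate Lambda (pull f a) c'.
  move=> c'a; rewrite -offrate_pull //; apply: eq_bigr => b /eqP bc.
  by rewrite rate_off //; apply: contra_neq c'a => ->.
have [e|ca] := eqVneq c (pull f a); last by rewrite off // rate_off // eq_sym.
rewrite {2}e {2}/rate eqxx.
have /eqP := sum_rate a.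
rewrite (bigID (fun b => pull f b == c)) /= addr_eq0 => /eqP ->; congr (- _).
rewrite (partition_big (pull f) (fun c' => c' != pull f a)) /=; last first.
  by move=> b; rewrite e.
apply: eq_bigr => c' c'a; rewrite -off //; apply: eq_bigl => b.
by have [->|] := eqVneq (pull f b) c'; rewrite ?andbF // andbT e.
Qed.

Lemma Qpow_partition k n (a b : {set {set 'I_n}}) :
  partition a [set: 'I_n] -> ~~ partition b [set: 'I_n] -> Qpow Lambda k a b = 0.
Proof.
move=> pa; elim: k b => [|k IH] b pb /=.
  by case: eqP => // e; move: pb; rewrite -e pa.
rewrite big1 // => c _; have [pc|pc] := boolP (partition c [set: 'I_n]).
  by rewrite rate_partition // mulr0.
by rewrite IH // mul0r.
Qed.

Lemma Qpow_pull k (a : {set {set 'I_N}}) (c : {set {set 'I_m}}) :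
  partition a [set: 'I_N] ->
  \sum_(b | pull f b == c) Qpow Lambda k a b = Qpow Lambda k (pull f a) c.
Proof.
move=> pa; elim: k c => [|k IH] c /=.
  rewrite big_mkcond /= (bigD1 a) //= eqxx big1 ?addr0 => [|b ba].
    by case: eqP.
  by rewrite [a == b]eq_sym (negbTE ba) if_same.
rewrite exchange_big /= (partition_big (pull f) predT) //=.
apply: eq_bigr => c' _; rewrite -IH mulr_suml; apply: eq_bigr => e /eqP ec.
rewrite -mulr_sumr; have [pe|pe] := boolP (partition e [set: 'I_N]).
  by rewrite rate_pull // ec.
by rewrite Qpow_partition // !mul0r.
Qed.

End Pull.

Lemma Qpow_bound n : exists2 C : R, 0 <= C &
  forall k (a b : {set {set 'I_n}}), `|Qpow Lambda k a b| <= C ^+ k.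
Proof.
pose C := \sum_(c : {set {set 'I_n}}) \sum_(b : {set {set 'I_n}}) `|rate Lambda c b|.
exists C.
  by apply: sumr_ge0 => c _; apply: sumr_ge0.
elim=> [|k IH] a b /=.
  by rewrite expr0; case: eqP => _; rewrite ?normr1 ?normr0.
rewrite (le_trans (ler_norm_sum _ _ _)) // exprSr /C mulr_sumr ler_sum // => c _.
rewrite normrM ler_pM // (bigD1 b) //= lerDl.
by apply: sumr_ge0.
Qed.

Lemma trans_cvg n t (a b : {set {set 'I_n}}) :
  cvgn (fun K : nat => \sum_(k < K) (t ^+ k / (k`!)%:R * Qpow Lambda k a b)).
Proof.
have [C C0 QC] := Qpow_bound n.
pose u k := t ^+ k / (k`!)%:R * Qpow Lambda k a b.
have -> : (fun K : nat => \sum_(k < K) (t ^+ k / (k`!)%:R * Qpow Lambda k a b))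
  = series u by apply/funext => K; rewrite seriesEord.
apply: normed_cvg.
apply: (@series_le_cvg _ _ (sequences.exp_coeff (`|t| * C))).
- by move=> k /=.
- by move=> k; rewrite sequences.exp_coeff_ge0 // mulr_ge0.
- move=> k /=; rewrite /u /sequences.exp_coeff /= !normrM normfV normrX.
  rewrite (ger0_norm (ler0n _ _)) exprMn mulrAC ler_wpM2r ?invr_ge0 //.
  by rewrite ler_wpM2l // exprn_ge0.
- exact: is_cvg_series_exp_coeff.
Qed.

Lemma trans_partition n t (a b : {set {set 'I_n}}) :
  partition a [set: 'I_n] -> ~~ partition b [set: 'I_n] -> trans Lambda t a b = 0.
Proof.
move=> pa pb; rewrite /trans.
rewrite (_ : (fun _ => _) = cst 0) ?lim_cst //; apply/funext => K.
by rewrite big1 // => k _; rewrite Qpow_partition // mulr0.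
Qed.

Lemma trans_pull m N (f : 'I_m -> 'I_N) t (a : {set {set 'I_N}}) c :
  partition a [set: 'I_N] ->
  \sum_(b | pull f b == c) trans Lambda t a b = trans Lambda t (pull f a) c.
Proof.
move=> pa; rewrite /trans; apply/esym/cvg_lim => //.
rewrite (_ : (fun _ => _) = (fun K => \sum_(b | pull f b == c)
    \sum_(k < K) (t ^+ k / (k`!)%:R * Qpow Lambda k a b))); last first.
  apply/funext => K; rewrite exchange_big /=; apply: eq_bigr => k _.
  by rewrite -mulr_sumr Qpow_pull.
apply: cvg_big => [|b _]; [exact: add_continuous|exact: trans_cvg].
Qed.

Fixpoint set_fidi (n : nat) (t0 : R) (a : {set {set 'I_n}})
    (l : seq (R * {set {set {set 'I_n}}})) : R :=
  match l with
  | [::] => 1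
  | (t, D) :: l' => \sum_(b in D) trans Lambda (t - t0) a b * set_fidi t b l'
  end.

Lemma fidiE n t0 (a : {set {set 'I_n}}) l :
  fidi Lambda t0 a l = set_fidi t0 a [seq (p.1, [set p.2]%SET) | p <- l].
Proof.
by elim: l t0 a => [//|[t b] l IH] t0 a /=; rewrite big_set1 IH.
Qed.

Definition pull_events m N (f : 'I_m -> 'I_N)
    (l : seq (R * {set {set {set 'I_m}}})) : seq (R * {set {set {set 'I_N}}}) :=
  [seq (p.1, (pull f @^-1: (p.2 : {set _}))%SET)
     | p : R * {set {set {set 'I_m}}} <- l].

Lemma set_fidi_pull m N (f : 'I_m -> 'I_N) t0 (a : {set {set 'I_N}}) l :
  partition a [set: 'I_N] ->
  set_fidi t0 a (pull_events f l) = set_fidi t0 (pull f a) l.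
Proof.
rewrite /pull_events; elim: l t0 a => [//|[t D] l IH] t0 a pa /=.
rewrite (partition_big (pull f) (mem D)) /=; last by move=> b; rewrite inE.
apply: eq_bigr => c cD; rewrite -trans_pull // mulr_suml; apply: eq_big => b.
  by rewrite inE; case: eqP => [->|]; rewrite ?andbF ?cD.
move=> /andP[_ /eqP bc]; have [pb|pb] := boolP (partition b [set: 'I_N]).
  by rewrite IH // bc.
by rewrite trans_partition // !mul0r.
Qed.

Lemma set_fidi_cat n t0 (a : {set {set 'I_n}}) l T
    (D : {set {set {set 'I_n}}}) l2 c :
  partition a [set: 'I_n] ->
  (forall b, b \in D -> partition b [set: 'I_n] -> set_fidi T b l2 = c) ->
  set_fidi t0 a (l ++ (T, D) :: l2) = set_fidi t0 a (rcons l (T, D)) * c.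
Proof.
move=> + Dc; elim: l t0 a => [|[t E] l IH] t0 a pa /=; rewrite mulr_suml.
  apply: eq_bigr => b bD; have [pb|pb] := boolP (partition b [set: 'I_n]).
    by rewrite (Dc b) // mulr1.
  by rewrite trans_partition // !mul0r.
apply: eq_bigr => b bE; have [pb|pb] := boolP (partition b [set: 'I_n]).
  by rewrite IH // mulrA.
by rewrite trans_partition // !mul0r.
Qed.

End Lumping.

Section FiniteValued.
Set Implicit Arguments.
Unset Strict Implicit.
Variables (d : measure_display) (Omega : measurableType d) (F : finType).
Variable Y : Omega -> F.
Hypothesis mY : forall b, measurable [set w | Y w = b].

Lemma measurable_finite_valued (D : pred F) : measurable [set w | D (Y w)].
Proof.
rewrite (_ : mkset _ = \bigcup_(b in [set b | D b]) [set w | Y w = b]).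
  by apply: fin_bigcup_measurable => // ; exact: finite_finset.
by apply/seteqP; split => [w /= Dw|w [b /= Db ->]] //; exists (Y w).
Qed.

Lemma measure_finite_valued (R : realType) (mu : {measure set Omega -> \bar R})
    (A : set Omega) (D : {set F}) : measurable A ->
  mu (A `&` [set w | Y w \in D]) =
  (\sum_(b in D) mu (A `&` [set w | Y w = b]))%E.
Proof.
move=> mA; rewrite -big_enum /=.
rewrite (_ : _ `&` _ = \bigcup_(b in [set` enum D]) (A `&` [set w | Y w = b])).
  rewrite measure_fin_bigcup //.
  - by rewrite [RHS]fsbig_seq ?enum_uniq.
  - by apply/classical_sets.trivIsetP => b c _ _ bc; apply/seteqP; split => // w [[_ /= e] [_ /= e']];
       move: bc; rewrite -e -e' eqxx.
  - by move=> b _; exact: measurableI.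
apply/seteqP; split => [w [Aw /= Dw]|w [b /=]].
  by exists (Y w) => //=; rewrite mem_enum.
by rewrite mem_enum => bD [Aw eb]; split => //=; rewrite eb.
Qed.

End FiniteValued.

(** * Markov property relative to the past *)

Section MarkovProperty.
Set Implicit Arguments.
Unset Strict Implicit.
Variables (R : realType) (Lambda : {finite_measure set R -> \bar R}).
Variables (d : measure_display) (Omega : measurableType d).
Variables (P : probability Omega R) (T0 : R) (X : R -> Omega -> nat -> nat -> bool).
Hypothesis coalX : lambda_coalescent Lambda P T0 X.

Definition cylinder (n : nat) (l : seq (R * {set {set {set 'I_n}}})) : set Omega :=
  [set w | all (fun p : R * {set {set {set 'I_n}}} =>
                  restr n (X p.1 w) \in p.2) l].

Lemma coalescent_equivalence t w : T0 <= t -> equivalence_rel (X t w).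
Proof. by case: coalX => + _; exact. Qed.

Lemma coalescent_measurable n t b : T0 <= t -> measurable [set w | restr n (X t w) = b].
Proof. by case: coalX => _ /(_ n)[+ _]; exact. Qed.

Lemma cylinder_measurable n (l : seq (R * {set {set {set 'I_n}}})) :
  all (>= T0) (map fst l) -> measurable (cylinder l).
Proof.
elim: l => [_|[t D] l IH /= /andP[T0t lT0]].
  by rewrite (_ : cylinder _ = setT) //; exact/seteqP.
rewrite (_ : cylinder _ = [set w | restr n (X t w) \in D] `&` cylinder l).
  apply: measurableI; last exact: IH.
  exact: (measurable_finite_valued (fun b => coalescent_measurable b T0t)).
by apply/seteqP; split => [w /andP[]|w [] *]; [split|apply/andP].
Qed.

Lemma fidi_rcons n t0 (a : {set {set 'I_n}}) l t b :
  fidi Lambda t0 a (rcons l (t, b)) =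
  fidi Lambda t0 a l * trans Lambda (t - (last (t0, a) l).1) (last (t0, a) l).2 b.
Proof.
elim: l t0 a => [|[s c] l IH] t0 a /=; first by rewrite mulrC.
by rewrite IH mulrA.
Qed.

Lemma path_fst (A : Type) (x : R * A) (l : seq (R * A)) :
  path (fun p q => p.1 <= q.1) x l = path <=%R x.1 (map fst l).
Proof. by rewrite path_map. Qed.

Lemma probability_cylinder_aux n
    (l1 : seq (R * {set {set 'I_n}})) (l2 : seq (R * {set {set {set 'I_n}}})) :
  path <=%R T0 (map fst l1 ++ map fst l2) ->
  P ([set w | all (fun p => restr n (X p.1 w) == p.2) l1] `&` cylinder l2) =
  (fidi Lambda T0 (Defs.singletons n) l1 *
   set_fidi Lambda (last (T0, Defs.singletons n) l1).1
     (last (T0, Defs.singletons n) l1).2 l2)%:E.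
Proof.
elim: l2 l1 => [|[t D] l2 IH] l1 /= pl.
  rewrite cats0 in pl; rewrite mulr1.
  have [_ /(_ n)[_ <-]] := coalX; last by rewrite path_fst.
  by congr (P _); apply/seteqP; split => [w []//|w *]; split.
have pl' := pl.
move: pl; rewrite cat_path => /andP[pl1 /= /andP[tl1 pl2]].
have /allP T0l : all (>= T0) (map fst l1 ++ t :: map fst l2).
  exact: order_path_min le_trans pl'.
have T0t : T0 <= t by apply: T0l; rewrite mem_cat mem_head orbT.
rewrite (_ : _ `&` _ =
  ([set w | all (fun p => restr n (X p.1 w) == p.2) l1] `&` cylinder l2) `&`
  [set w | restr n (X t w) \in D]); last first.
  apply/seteqP; split => [w [h /andP[]]|w [[h1 h2] h3]] //.
  by split => //; apply/andP.
rewrite (measure_finite_valued (fun b => coalescent_measurable b T0t)); last first.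
  apply: measurableI; last first.
    by apply: cylinder_measurable; apply/allP => x xl; apply: T0l;
       rewrite mem_cat inE xl !orbT.
  rewrite (_ : mkset _ = cylinder [seq (p.1, [set p.2]%SET) | p <- l1]).
    apply: cylinder_measurable; rewrite -map_comp; apply/allP => x xl.
    by apply: T0l; rewrite mem_cat xl.
  apply/seteqP; split => w; rewrite /cylinder /= all_map;
    by apply: sub_all => p /=; rewrite finset.in_set1.
rewrite mulr_sumr -sumEFin; apply: eq_bigr => b _.
rewrite mulrA -fidi_rcons.
have := IH (rcons l1 (t, b)); rewrite map_rcons cat_rcons last_rcons => <- //.
congr (P _); apply/seteqP; split => w /=; rewrite all_rcons /=.
  by move=> [[h1 h2] ->]; rewrite eqxx.
by move=> [/andP[/eqP-> h1] h2].
Qed.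

Lemma probability_cylinder n (l : seq (R * {set {set {set 'I_n}}})) :
  path <=%R T0 (map fst l) ->
  P (cylinder l) = (set_fidi Lambda T0 (Defs.singletons n) l)%:E.
Proof.
move=> pl; have := @probability_cylinder_aux n [::] l pl; rewrite mul1r => <-.
by congr (P _); apply/seteqP; split => [w *|w []//]; split.
Qed.

Lemma cylinder_pull m N (f : 'I_m -> 'I_N) (k : nat -> nat)
    (l : seq (R * {set {set {set 'I_m}}})) :
  (forall i : 'I_m, k i = f i :> nat) -> all (>= T0) (map fst l) ->
  cylinder (pull_events f l) =
  [set w | all (fun p : R * {set {set {set 'I_m}}} =>
                  restr m (fun i j => X p.1 w (k i) (k j)) \in p.2) l].
Proof.
move=> kf /allP lT0.
apply/funext => w; rewrite /cylinder /mkset /pull_events all_map; congr is_true.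
apply: eq_in_all => p pl /=; rewrite finset.inE.
by rewrite (pull_restr (coalescent_equivalence w (lT0 _ (map_f fst pl))) kf).
Qed.

Lemma map_fst_pull_events m N (f : 'I_m -> 'I_N)
    (l : seq (R * {set {set {set 'I_m}}})) :
  map fst (pull_events f l) = map fst l.
Proof. by rewrite -map_comp. Qed.

Lemma cylinder_cat n (l1 l2 : seq (R * {set {set {set 'I_n}}})) :
  cylinder (l1 ++ l2) = cylinder l1 `&` cylinder l2.
Proof.
by apply/seteqP; split => w; rewrite /cylinder /= all_cat => /andP.
Qed.

Lemma cylinder_perm n (l1 l2 : seq (R * {set {set {set 'I_n}}})) :
  perm_eq l1 l2 -> cylinder l1 = cylinder l2.
Proof.
by move=> p12; apply/funext => w; rewrite /cylinder /mkset (perm_all _ p12).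
Qed.

Lemma cylinder_widen m N (l : seq (R * {set {set {set 'I_m}}})) :
  (m <= N)%N -> all (>= T0) (map fst l) ->
  exists l' : seq (R * {set {set {set 'I_N}}}),
    map fst l' = map fst l /\ cylinder l' = cylinder l.
Proof.
move=> mN lT0; exists (pull_events (widen_ord mN) l).
by rewrite map_fst_pull_events (cylinder_pull (k := id)).
Qed.

Definition sampled n (k : nat -> nat) (l : seq (R * {set {set {set 'I_n}}})) :
    set Omega :=
  [set w | all (fun p : R * {set {set {set 'I_n}}} =>
                  restr n (fun i j => X p.1 w (k i) (k j)) \in p.2) l].

Lemma sampled_cylinder n (k : nat -> nat) B (l : seq (R * {set {set {set 'I_n}}})) :
  (\max_(i < n) k i <= B)%N -> all (>= T0) (map fst l) ->
  sampled k l = cylinder (pull_events (fun i : 'I_n => inord (k i) : 'I_B.+1) l).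
Proof.
move=> /bigmax_leqP kB lT0; rewrite (cylinder_pull (k := k)) // => i.
by rewrite inordK // ltnS; exact: kB.
Qed.

Lemma sampled_measurable n (k : nat -> nat) (l : seq (R * {set {set {set 'I_n}}})) :
  all (>= T0) (map fst l) -> measurable (sampled k l).
Proof.
move=> lT0; rewrite (sampled_cylinder (leqnn _)) //; apply: cylinder_measurable.
by rewrite map_fst_pull_events.
Qed.

Definition past_cylinders (T : R) : set (set Omega) :=
  [set A | exists n (l : seq (R * {set {set {set 'I_n}}})),
     all (fun t => T0 <= t <= T) (map fst l) /\ A = cylinder l].

Lemma past_times_ge T (s : seq R) :
  all (fun t => T0 <= t <= T) s -> all (>= T0) s.
Proof. by apply: sub_all => t /andP[]. Qed.

Lemma past_cylindersI T : setI_closed (past_cylinders T).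
Proof.
move=> _ _ [n [l [lT ->]]] [m [l' [lT' ->]]].
have [l1 [e1 <-]] := cylinder_widen (leq_maxl n m) (past_times_ge lT).
have [l2 [e2 <-]] := cylinder_widen (leq_maxr n m) (past_times_ge lT').
exists (maxn n m), (l1 ++ l2); rewrite map_cat all_cat e1 e2 lT lT'.
by rewrite cylinder_cat.
Qed.

Lemma markov_past_cylinder n (k : nat -> nat) T c0 (l : seq (R * {set {set 'I_n}})) A :
  T0 <= T -> path <=%R T (map fst l) -> past_cylinders T A ->
  P (A `&` sampled k ((T, [set c0]%SET) :: [seq (p.1, [set p.2]%SET) | p <- l])) =
  (P (A `&` sampled k [:: (T, [set c0]%SET)]) * (fidi Lambda T c0 l)%:E)%E.
Proof.
move=> T0T pl [m [l0 [lT ->]]].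
set L := [seq (p.1, [set p.2]%SET) | p <- l].
have mapL : map fst L = map fst l by rewrite -map_comp.
have LT0 : all (>= T0) (T :: map fst L).
  rewrite /= T0T mapL; apply/allP => x xl; rewrite /= (le_trans T0T) //.
  by move: x xl; apply/allP; exact: order_path_min le_trans pl.
pose B := maxn m (\max_(i < n) k i).
have [l1 [e1 <-]] := cylinder_widen (leqW (leq_maxl m (\max_(i < n) k i)))
  (past_times_ge lT).
pose f (i : 'I_n) : 'I_B.+1 := inord (k i).
rewrite !(sampled_cylinder (leq_maxr m _)) //=; last by rewrite T0T.
pose leT (p q : R * {set {set {set 'I_B.+1}}}) := p.1 <= q.1.
pose l2 := sort leT l1.
have sort_l2 : sorted <=%R (map fst l2).
  by rewrite sorted_map; apply: sort_sorted => p q; exact: le_total.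
have /allP l2T : all (fun t => T0 <= t <= T) (map fst l2).
  rewrite (perm_all _ (perm_map fst (permEl (perm_sort leT l1)))).
  by rewrite e1.
rewrite -/B -/f -(cylinder_perm (permEl (perm_sort leT l1))) -/l2 -!cylinder_cat.
have pathl2 : path <=%R T0 (rcons (map fst l2) T).
  rewrite rcons_path; apply/andP; split.
    by rewrite path_min_sorted //; apply/allP => t /l2T /andP[].
  by have := mem_last T0 (map fst l2); rewrite inE => /predU1P[->//|/l2T/andP[]].
have pathL : path <=%R T0 (map fst (l2 ++ pull_events f ((T, [set c0]%SET) :: L))).
  rewrite map_cat map_fst_pull_events /= -cat_rcons cat_path pathl2 /=.
  by rewrite last_rcons mapL.
rewrite !probability_cylinder //; last first.
  by rewrite cats1 map_rcons.
rewrite -EFinM /= cats1; congr EFin; apply: set_fidi_cat.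
  exact: singletons_partition.
move=> b; rewrite !finset.inE => /eqP <- pb.
by rewrite set_fidi_pull // fidiE.
Qed.

Lemma markov_property n (k : nat -> nat) T c0 (l : seq (R * {set {set 'I_n}})) A :
  T0 <= T -> path <=%R T (map fst l) -> <<s past_cylinders T >> A ->
  P (A `&` sampled k ((T, [set c0]%SET) :: [seq (p.1, [set p.2]%SET) | p <- l])) =
  (P (A `&` sampled k [:: (T, [set c0]%SET)]) * (fidi Lambda T c0 l)%:E)%E.
Proof.
move=> T0T pl; set E1 := sampled k (_ :: _); set E0 := sampled k [:: _].
set c := fidi _ _ _ _.
have mE0 : measurable E0 by apply: sampled_measurable; rewrite /= T0T.
have mE1 : measurable E1.
  apply: sampled_measurable; rewrite /= T0T -map_comp.
  apply/allP => x xl; rewrite /= (le_trans T0T) //.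
  by move: x xl; apply/allP; exact: order_path_min le_trans pl.
have Mpi B : past_cylinders T B -> P (B `&` E1) = (P (B `&` E0) * c%:E)%E.
  exact: markov_past_cylinder.
pose H := [set B | measurable B /\ P (B `&` E1) = (P (B `&` E0) * c%:E)%E].
suff : <<s past_cylinders T >> `<=` H by move=> /[apply] -[].
have HT : H setT.
  split => //; apply: Mpi; exists 0%N, [::]; split => //.
  by apply/esym/seteqP.
apply: lambda_system_subset => //; first exact: past_cylindersI.
  apply/dynkin_lambda_system; split => //.
  - move=> B [mB eB]; split; first exact: measurableC.
    have PC E : measurable E -> P (~` B `&` E) = (P E - P (B `&` E))%E.
      move=> mE; rewrite setIC -setDE measureD //; first by rewrite setIC.
      by rewrite ltey_eq fin_num_measure.
    rewrite !PC // eB; case: HT => _; rewrite !setTI => ->.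
    by rewrite muleBl ?fin_num_adde_defr // fin_num_measure //; exact: measurableI.
  - move=> F tF HF; split; first by apply: bigcupT_measurable => i; case: (HF i).
    have mF i : measurable (F i) by case: (HF i).
    have PU E : measurable E -> P (\bigcup_i F i `&` E) = (\sum_(i <oo) P (F i `&` E))%E.
      move=> mE; rewrite setI_bigcupl measure_bigcup //.
      + by apply: eq_eseriesl => i; rewrite in_setT.
      + by move=> i _; exact: measurableI.
      + exact: trivIset_setIr.
    rewrite !PU // muleC -nneseriesZl //; apply: eq_eseriesr => i _.
    by case: (HF i) => _ ->; rewrite muleC.
move=> B GB; split; last exact: Mpi.
by case: GB => m [l' [lT ->]]; apply: cylinder_measurable; exact: past_times_ge lT.
Qed.

End MarkovProperty.

Lemma eq_restr n (X Y : nat -> nat -> bool) :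
  (forall i j, (i < n)%N -> (j < n)%N -> X i j = Y i j) -> restr n X = restr n Y.
Proof.
move=> XY; apply/finset.setP => B.
apply/restrP/restrP => -[i ->]; exists i; apply/finset.setP => j;
  by rewrite !finset.inE XY.
Qed.

Lemma mkseq_sigma_algebra (T : pointedType) (G : set (set T)) (W : T -> nat -> nat) n s :
  (forall i k, <<s G >> [set w | W w i = k]) ->
  <<s G >> [set w | mkseq (W w) n = s].
Proof.
move=> mW.
have s0 : <<s G >> set0 by exact: sigma_algebra0.
have sI A B : <<s G >> A -> <<s G >> B -> <<s G >> (A `&` B).
  exact: (@measurableI _ (g_sigma_algebraType G)).
elim: n s => [|n IH] s.
  have [->|/eqP s_neq] := eqVneq s [::].
    rewrite (_ : mkset _ = setT); last exact/seteqP.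
    exact: (@measurableT _ (g_sigma_algebraType G)).
  by rewrite (_ : mkset _ = set0) //; apply/seteqP; split => // w /esym.
case/lastP: s => [|s x].
  by rewrite (_ : mkset _ = set0) //; apply/seteqP; split.
rewrite (_ : mkset _ = [set w | mkseq (W w) n = s] `&` [set w | W w n = x]).
  by apply: sI.
apply/seteqP; split => w /=; rewrite mkseqS; last by move=> [-> ->].
by move=> /rcons_inj[].
Qed.

Theorem theorem6 (R : realType) (Lambda : {finite_measure set R -> \bar R})
  (d : measure_display) (Omega : measurableType d) (P : probability Omega R)
  (Pi : R -> Omega -> nat -> nat -> bool)
  (T : R) (W : Omega -> nat -> nat) :
  Lambda (~` `[0, 1]%classic) = 0%E ->
  Lambda [set 1] = 0%E ->
  lambda_coalescent Lambda P 0 Pi ->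
  0 < T ->
  (forall (i k : nat), <<s natural_gens Pi T >> [set w | W w i = k]) ->
  (forall w (i j : nat), (i < j)%N -> (W w i < W w j)%N) ->
  (forall w (m : nat), exists! i : nat, Pi T w (W w i) m) ->
  lambda_coalescent Lambda P T (fun t w i j => Pi t w (W w i) (W w j)).
Proof.
move=> _ _ coal /ltW T0 mW _ uniqW.
have eqv t w : T <= t -> equivalence_rel (Pi t w).
  by move=> Tt; apply: (coalescent_equivalence coal); exact: le_trans Tt.
split => [t w Tt i j k|n]; first exact: eqv.
pose B c := [set w | pickle (mkseq (W w) n) = c].
have BP c : B c = set0 \/ exists s, B c = [set w | mkseq (W w) n = s].
  have [[s <-]|nc] := pselect (exists s : seq nat, pickle s = c); [right|left].
    exists s; rewrite /B; apply/seteqP; split => w /=; last by move=> ->.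
    exact: (pcan_inj (@pickleK _)).
  by apply/seteqP; split => // w Bw; apply: nc; exists (mkseq (W w) n).
have tB : trivIset setT B.
  by apply/classical_sets.trivIsetP => b c _ _ bc; apply/seteqP; split => // w [e e'];
     move: bc; rewrite -e -e' eqxx.
have UB : \bigcup_c B c = setT.
  by apply/seteqP; split => // w _; exists (pickle (mkseq (W w) n)).
have FT_past : <<s natural_gens Pi T >> `<=` <<s past_cylinders 0 Pi T >>.
  apply: sub_smallest2r; first exact: smallest_sigma_algebra.
  move=> _ [s [m [S [sT ->]]]].
  exists m, [:: (s, [set S]%SET)]; split; first by rewrite /= sT.
  by apply/seteqP; split => w; rewrite /cylinder /= finset.in_set1 andbT => /eqP.
have sB c : <<s past_cylinders 0 Pi T >> (B c).
  have [->|[s ->]] := BP c; last first.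
    by apply: FT_past; exact: mkseq_sigma_algebra.
  exact: sigma_algebra0.
have past_measurable A : <<s past_cylinders 0 Pi T >> A -> measurable A.
  apply: smallest_sub; first exact: sigma_algebra_measurable.
  move=> _ [m [l [lT ->]]]; apply: (cylinder_measurable coal).
  exact: past_times_ge lT.
have mB c : measurable (B c) by apply: past_measurable; exact: sB.
have restrW t w s : mkseq (W w) n = s ->
    restr n (fun i j => Pi t w (W w i) (W w j)) =
    restr n (fun i j => Pi t w (nth 0%N s i) (nth 0%N s j)).
  by move=> <-; apply: eq_restr => i j ni nj; rewrite !nth_mkseq.
split.
  move=> t S Tt.
  rewrite (_ : mkset _ = \bigcup_c (B c `&`
    [set w | restr n (fun i j => Pi t w (W w i) (W w j)) = S])); last first.
    by rewrite -setI_bigcupl UB setTI.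
  apply: bigcupT_measurable => c.
  have [->|[s Bs]] := BP c; first by rewrite set0I.
  rewrite (_ : _ `&` _ = B c `&` sampled Pi (nth 0%N s) [:: (t, [set S]%SET)]).
    apply: measurableI => //; apply: (sampled_measurable coal).
    by rewrite /= (le_trans T0 Tt).
  rewrite Bs; apply/seteqP; split => w [e]; rewrite /sampled /= finset.in_set1 andbT.
    by rewrite (restrW _ _ s) // => ->; split.
  by move=> /eqP <-; split => //; rewrite (restrW _ _ s).
move=> l; rewrite path_fst /= => pl.
set E := mkset _; set c0 := Defs.singletons n.
have WT w : restr n (fun i j => Pi T w (W w i) (W w j)) = c0.
  have Wr j : Pi T w (W w j) (W w j).
    by have [] := eqv T w (lexx T) (W w j) (W w j) (W w j).
  apply: eq_restr => i j _ _; apply/idP/eqP => [Wij|->//].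
  by have [i0 [_ u]] := uniqW w (W w j); rewrite -(u i Wij) -(u j).
pose future := (T, [set c0]%SET) :: [seq (p.1, [set p.2]%SET) | p <- l].
have BE c s : B c = [set w | mkseq (W w) n = s] ->
    B c `&` E = B c `&` sampled Pi (nth 0%N s) future.
  move=> ->; apply/seteqP.
  split => w [e]; rewrite /E /sampled /= -(restrW T w s) // WT finset.in_set1 eqxx /=;
    rewrite all_map => al; split => //; apply: sub_all al => p /=;
    by rewrite finset.in_set1 (restrW _ _ s).
have PBE c : P (B c `&` E) = ((fidi Lambda T c0 l)%:E * P (B c))%E.
  have [->|[s Bs]] := BP c; first by rewrite set0I measure0 mule0.
  rewrite (BE c s) // (markov_property coal (nth 0%N s) c0 T0 pl (sB c)) muleC.
  congr (_ * P _)%E; apply/setIidPl => w; rewrite Bs /sampled /= => e.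
  by rewrite -(restrW _ _ s) // WT finset.in_set1 eqxx.
have mBE c : measurable (B c `&` E).
  have [->|[s Bs]] := BP c; first by rewrite set0I.
  rewrite (BE c s) //; apply: measurableI => //; apply: (sampled_measurable coal).
  rewrite /= T0 -map_comp; apply/allP => x xl; rewrite /= (le_trans T0) //.
  by move: x xl; apply/allP; exact: order_path_min le_trans pl.
rewrite -(setTI E) -UB setI_bigcupl measure_bigcup //; last exact: trivIset_setIr.
rewrite (eq_eseriesr (fun c _ => PBE c)) nneseriesZl //.
rewrite -measure_bigcup // UB.
by rewrite -[RHS]mule1; congr (_ * _)%E; exact: probability_setT.
Qed.
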